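(* Let $X$ be a Hausdorff topological group with operations and let $G$ be a regular $G$-method for $X$ which preserves the $G$-convergence of subsequences. Then every $G$-compact subset of $X\times X$ is $G$-closed.
   Context: Groups with operations. A category of groups with operations consists of groups (written additively, not necessarily abelian) with a set of operations $\Omega=\Omega_0\cup\Omega_1\cup\Omega_2$ ($\Omega_i$ the $i$-ary operations) and a set of identities including the group laws, such that: $\Omega_0=\{0\}$; $-\in\Omega_1$, $+\in\Omega_2$; with $\Omega_1'=\Omega_1\setminus\{-\}$ and $\Omega_2'=\Omega_2\setminus\{+\}$, if $\star\in\Omega_2'$ then $\star^\circ$, defined by $x\star^\circ y=y\star x$, is in $\Omega_2'$; and for $\star\in\Omega_2'$, $\omega\in\Omega_1'$ the identities $x\star(y+z)=x\star y+x\star z$, $\omega(x+y)=\omega(x)+\omega(y)$, $\omega(x)\star y=\omega(x\star y)$ hold. A morphism of groups with operations is a group homomorphism preserving the operations of $\Omega_1'$ and $\Omega_2'$. A subgroup with operations is a subgroup closed under all operations in $\Omega_1$ and $\Omega_2$. A topological group with operations is such an object with a topology making all operations continuous. $G$-methods. Let $s(X)$ be the set of all sequences in $X$, a group with operations under termwise operations. A $G$-method for $X$ is a morphism of groups with operations $G\colon c_G(X)\to X$ defined on a subgroup with operations $c_G(X)$ of $s(X)$. A sequence $\mathbf{x}$ is $G$-convergent to $\ell$ if $\mathbf{x}\in c_G(X)$ and $G(\mathbf{x})=\ell$; writing $G(\mathbf{x})=\ell$ includes $\mathbf{x}\in c_G(X)$. $G$ is regular if every convergent sequence $\mathbf{x}$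 in $X$ lies in $c_G(X)$ and $G(\mathbf{x})=\lim\mathbf{x}$. $G$ preserves the $G$-convergence of subsequences if, whenever $G(\mathbf{x})=\ell$, every subsequence of $\mathbf{x}$ is also $G$-convergent to $\ell$. Product. $X\times X$ carries the product topology and componentwise operations, and $G$ is applied to sequences in $X\times X$ componentwise: $(\mathbf{x},\mathbf{y})=((x_n,y_n))$ is $G$-convergent iff $\mathbf{x}$ and $\mathbf{y}$ are, and then $G(\mathbf{x},\mathbf{y})=(G(\mathbf{x}),G(\mathbf{y}))$. $G$-closedness and $G$-compactness. A subset $A$ of $X\times X$ is $G$-closed if whenever $\mathbf{x}$ is a sequence of points of $A$ with $G(\mathbf{x})=\ell$, then $\ell\in A$. It is $G$-compact if every sequence of points in $A$ has a subsequence $\mathbf{y}$ with $G(\mathbf{y})=\ell\in A$. *)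

(* Defs.v *)
From HB Require Import structures.
From mathcomp Require Import all_boot all_order.
From mathcomp Require Import all_classical all_reals all_analysis.

Set Implicit Arguments.
Unset Strict Implicit.
Unset Printing Implicit Defensive.

Local Open Scope group_scope.
Local Open Scope classical_set_scope.

(** The library's not necessarily abelian groups ([groupType]) are written
    multiplicatively: [x * y], [1] and [x^-1] below are the x + y, 0 and -x of
    groups with operations. *)

(** [unary] and [binary] are the operations other than - and +, i.e. Omega_1'
    and Omega_2'; [opposite] sends a binary operation to the one obtained by
    exchanging its arguments. *)
Record signature := Signature {
  unary : Type;
  binary : Type;
  opposite : binary -> binary
}.

Inductive term (S : signature) : Type :=
  | Var of nat
  | Zero
  | Opp of term S
  | Add of term S & term S
  | Unary of unary S & term S
  | Binary of binary S & term S & term S.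
Arguments Var {S}.
Arguments Zero {S}.

(** A category of groups with operations. [identity] lists the identities
    imposed in addition to those required in every such category, which are
    the fields of [isGroupWithOps] and the group laws. *)
Record op_category := OpCategory {
  op_signature :> signature;
  identity : term op_signature -> term op_signature -> Prop
}.

Fixpoint eval (S : signature) (X : groupType) (un : unary S -> X -> X)
    (bin : binary S -> X -> X -> X) (env : nat -> X) (t : term S) : X :=
  match t with
  | Var i => env i
  | Zero => 1
  | Opp t => (eval un bin env t)^-1
  | Add t u => eval un bin env t * eval un bin env u
  | Unary w t => un w (eval un bin env t)
  | Binary s t u => bin s (eval un bin env t) (eval un bin env u)
  end.

HB.mixin Record isGroupWithOps (C : op_category) X of Group X := {
  unop : unary C -> X -> X;
  binop : binary C -> X -> X -> X;
  binop_opposite : forall s x y, binop (opposite s) x y = binop s y x;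
  binopMr : forall s x y z, binop s x (y * z) = binop s x y * binop s x z;
  unopM : forall w x y, unop w (x * y) = unop w x * unop w y;
  binop_unop : forall w s x y, binop s (unop w x) y = unop w (binop s x y);
  identityP : forall t u, identity t u ->
    forall env : nat -> X, eval unop binop env t = eval unop binop env u
}.

#[short(type="groupWithOpsType")]
HB.structure Definition GroupWithOps (C : op_category) :=
  {X of isGroupWithOps C X & Group X}.

HB.mixin Record hasContinuousOps (C : op_category) X
    of GroupWithOps C X & Topological X := {
  mulg_continuous : continuous (fun p : X * X => p.1 * p.2);
  invg_continuous : continuous (fun x : X => x^-1);
  unop_continuous : forall w : unary C, continuous (unop w : X -> X);
  binop_continuous : forall s : binary C,
    continuous (fun p : X * X => binop s p.1 p.2)
}.

#[short(type="topGroupWithOpsType")]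
HB.structure Definition TopGroupWithOps (C : op_category) :=
  {X of hasContinuousOps C X & GroupWithOps C X & Topological X}.

Section SequenceGroup.
Variable X : groupType.
Implicit Types x y : nat -> X.

Let seq_one : nat -> X := fun=> 1.
Let seq_inv x : nat -> X := fun n => (x n)^-1.
Let seq_mul x y : nat -> X := fun n => x n * y n.

Let seq_mulA : associative seq_mul.
Proof. by move=> x y z; apply/funext => n; exact: mulgA. Qed.
Let seq_mul1 : left_id seq_one seq_mul.
Proof. by move=> x; apply/funext => n; exact: mul1g. Qed.
Let seq_mul1r : right_id seq_one seq_mul.
Proof. by move=> x; apply/funext => n; exact: mulg1. Qed.
Let seq_mulV : left_inverse seq_one seq_inv seq_mul.
Proof. by move=> x; apply/funext => n; exact: mulVg. Qed.
Let seq_mulVr : right_inverse seq_one seq_inv seq_mul.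
Proof. by move=> x; apply/funext => n; exact: mulgV. Qed.

HB.instance Definition _ := isGroup.Build (nat -> X)
  seq_mulA seq_mul1 seq_mul1r seq_mulV seq_mulVr.
End SequenceGroup.

Section SequenceOps.
Variables (C : op_category) (X : groupWithOpsType C).
Implicit Types x y : nat -> X.

Let seq_unop (w : unary C) x : nat -> X := fun n => unop w (x n).
Let seq_binop (s : binary C) x y : nat -> X := fun n => binop s (x n) (y n).

Let eval_seq (env : nat -> nat -> X) (t : term C) (n : nat) :
  eval seq_unop seq_binop env t n =
  eval (@unop C X) (@binop C X) (env^~ n) t.
Proof.
elim: t => //=.
- by move=> t <-.
- by move=> t <- u <-.
- by move=> w t <-.
- by move=> s t <- u <-.
Qed.

Let seq_binop_opposite s x y : seq_binop (opposite s) x y = seq_binop s y x.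
Proof. by apply/funext => n; exact: binop_opposite. Qed.
Let seq_binopMr s x y z :
  seq_binop s x (y * z) = seq_binop s x y * seq_binop s x z.
Proof. by apply/funext => n; exact: binopMr. Qed.
Let seq_unopM w x y : seq_unop w (x * y) = seq_unop w x * seq_unop w y.
Proof. by apply/funext => n; exact: unopM. Qed.
Let seq_binop_unop w s x y :
  seq_binop s (seq_unop w x) y = seq_unop w (seq_binop s x y).
Proof. by apply/funext => n; exact: binop_unop. Qed.
Let seq_identityP t u : identity t u -> forall env : nat -> nat -> X,
  eval seq_unop seq_binop env t = eval seq_unop seq_binop env u.
Proof.
by move=> tu env; apply/funext => n; rewrite !eval_seq; exact: identityP.
Qed.

HB.instance Definition _ := isGroupWithOps.Build C (nat -> X)
  seq_binop_opposite seq_binopMr seq_unopM seq_binop_unop seq_identityP.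
End SequenceOps.

Record subgroup_with_ops (C : op_category) (X : groupWithOpsType C)
    (D : set X) : Prop := SubgroupWithOps {
  sub_one : D 1;
  sub_mul : forall x y, D x -> D y -> D (x * y);
  sub_inv : forall x, D x -> D x^-1;
  sub_unop : forall (w : unary C) x, D x -> D (unop w x);
  sub_binop : forall (s : binary C) x y, D x -> D y -> D (binop s x y)
}.

(** [f] is a morphism of groups with operations from the subgroup [D] to [Y];
    its values outside of [D] are irrelevant. *)
Record morphism_with_ops (C : op_category) (X Y : groupWithOpsType C)
    (D : set X) (f : X -> Y) : Prop := MorphismWithOps {
  morph_mul : forall x y, D x -> D y -> f (x * y) = f x * f y;
  morph_unop : forall (w : unary C) x, D x -> f (unop w x) = unop w (f x);
  morph_binop : forall (s : binary C) x y, D x -> D y ->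
    f (binop s x y) = binop s (f x) (f y)
}.

Section GMethod.
Variables (C : op_category) (X : topGroupWithOpsType C).

Record g_method := GMethod {
  g_dom : set (nat -> X);
  g_fun : (nat -> X) -> X;
  g_dom_subgroup : @subgroup_with_ops C (nat -> X) g_dom;
  g_fun_morphism : @morphism_with_ops C (nat -> X) X g_dom g_fun
}.

Variable G : g_method.

Definition g_converges (x : nat -> X) (l : X) : Prop :=
  g_dom G x /\ g_fun G x = l.

Definition g_regular : Prop :=
  forall (x : nat -> X) (l : X), x @ \oo --> l -> g_converges x l.

Definition g_preserves_subsequences : Prop :=
  forall (x : nat -> X) (l : X), g_converges x l ->
  forall k : nat -> nat, increasing_seq k -> g_converges (x \o k) l.

Definition g_converges_prod (z : nat -> X * X) (l : X * X) : Prop :=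
  g_converges (fst \o z) l.1 /\ g_converges (snd \o z) l.2.

Definition g_closed (A : set (X * X)) : Prop :=
  forall (z : nat -> X * X) (l : X * X),
    (forall n, A (z n)) -> g_converges_prod z l -> A l.

Definition g_compact (A : set (X * X)) : Prop :=
  forall z : nat -> X * X, (forall n, A (z n)) ->
  exists k : nat -> nat, increasing_seq k /\
    exists l : X * X, g_converges_prod (z \o k) l /\ A l.

End GMethod.

(* Main.v *)
Require Import Defs.
From mathcomp Require Import all_boot all_order.
From mathcomp Require Import all_classical all_reals all_analysis.

(** [G] is a function, so a sequence has at most one [G]-limit. If a sequence
    in [A] has the [G]-limit [l], then so does each of its subsequences,
    including the one that [G]-compactness sends to a point of [A]; hence that
    point is [l]. *)

Theorem theorem3p5 (C : op_category) (X : topGroupWithOpsType C)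
    (X_hausdorff : hausdorff_space X) (G : g_method X)
    (G_regular : g_regular G) (G_subseq : g_preserves_subsequences G)
    (A : set (X * X)) (A_compact : g_compact G A) :
  g_closed G A.
Proof.
move=> z [l1 l2] Az [/= z1 z2].
have [k [incr_k [[m1 m2] [[/= [_ <-] [_ <-]] Am]]]] := A_compact z Az.
have [_ <-] := G_subseq _ _ z1 _ incr_k.
by have [_ <-] := G_subseq _ _ z2 _ incr_k.
Qed.
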